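(* Let $\mathbb{K}$ be a field of characteristic zero and $d,t\ge1$ integers. For $\theta\in \mathrm{Aut}\,\mathfrak{n}_{d,t}$ and $B\in Obj(\mathbf{Sym}_0(d,t))$ let $B_\theta(x,y)=B(\theta(x),\theta(y))$; this defines an action of $\mathrm{Aut}\,\mathfrak{n}_{d,t}$ on $Obj(\mathbf{Sym}_0(d,t))$. For every $B\in Obj(\mathbf{Sym}_0(d,t))$, the orbit $\{B_\theta:\theta\in\mathrm{Aut}\,\mathfrak{n}_{d,t}\}$ is equal to the set of objects of $\mathbf{Sym}_0(d,t)$ that are isomorphic to $B$ in the category $\mathbf{Sym}_0(d,t)$. Therefore the number of orbits of this action is exactly the number of isomorphism types in the classification of $t$-nilpotent quadratic Lie algebras of type $d$ up to isometric isomorphism.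
   Context: All Lie algebras are over a field $\mathbb{K}$ of characteristic zero. For a Lie algebra $\mathfrak{n}$ put $\mathfrak{n}^1=\mathfrak{n}$, $\mathfrak{n}^i=[\mathfrak{n}^{i-1},\mathfrak{n}]$; $\mathfrak{n}$ is $t$-nilpotent if $\mathfrak{n}^{t+1}=0$ and $\mathfrak{n}^t\neq 0$. The type of a nilpotent Lie algebra $\mathfrak{n}$ is $\dim \mathfrak{n}/\mathfrak{n}^2$. $\mathfrak{n}_{d,t}=\mathfrak{FL}(d)/\mathfrak{FL}(d)^{t+1}$ is the free $t$-nilpotent Lie algebra on $d$ generators. A bilinear form $B$ is invariant if $B([x,y],z)=B(x,[y,z])$. A quadratic Lie algebra is a pair $(\mathfrak{n},B)$ with $B$ a nondegenerate symmetric invariant bilinear form. An isometric isomorphism $(\mathfrak{n},B)\to(\mathfrak{n}',B')$ is a Lie algebra isomorphism $\varphi$ with $B(x,y)=B'(\varphi(x),\varphi(y))$. $\mathrm{Ker}(B)=\{x : B(x,y)=0\ \forall y\}$. $\mathbf{Sym}_0(d,t)$ is the category whose objects are the invariant symmetric bilinear forms $B$ on $\mathfrak{n}_{d,t}$ with $\mathrm{Ker}(B)\subseteq \mathfrak{n}_{d,t}^2$ and $\mathfrak{n}_{d,t}^t\nsubseteq \mathrm{Ker}(B)$. For objects $B_1,B_2$ let $MEnd_\perp(B_1,B_2)$ be the set of Lie algebra endomorphisms $\varphi$ of $\mathfrak{n}_{d,t}$ such that $B_1(x,y)=B_2(\varphi(x),\varphi(y))$ for all $x,y$ and $\varphi(\mathrm{Ker}(B_1))\subseteq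 \mathrm{Ker}(B_2)$. Then $Hom(B_1,B_2)=MEnd_\perp(B_1,B_2)/\sim$, where $\varphi_1\sim\varphi_2$ iff $(\varphi_1-\varphi_2)(\mathfrak{n}_{d,t})\subseteq \mathrm{Ker}(B_2)$; composition is induced by composition of endomorphisms. *)

(* Defs.v *)
From HB Require Import structures.
From mathcomp Require Import all_boot all_order all_algebra.
From mathcomp Require Import generic_quotient.
From mathcomp Require Import boolp classical_sets functions cardinality.

Set Implicit Arguments.
Unset Strict Implicit.
Unset Printing Implicit Defensive.

Import GRing.Theory.
Local Open Scope classical_set_scope.
Local Open Scope quotient_scope.
Local Open Scope ring_scope.

Definition is_submod (K : fieldType) (V : lmodType K) (A : set V) : Prop :=
  A 0 /\ forall (a : K) (u v : V), A u -> A v -> A (a *: u + v).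

Record submod (K : fieldType) (V : lmodType K) := Submod {
  submod_set :> V -> Prop;
  submodP : is_submod submod_set }.

Definition linspan (K : fieldType) (V : lmodType K) (S : set V) : set V :=
  smallest (@is_submod K V) S.

Lemma linspan_submod (K : fieldType) (V : lmodType K) (S : set V) :
  is_submod (linspan S).
Proof.
split=> [A [[]]//|a u v Su Sv A [sA SA]].
by apply: sA.2; [apply: Su|apply: Sv].
Qed.

Section SubmodTheory.
Variables (K : fieldType) (V : lmodType K) (A : submod V).

Lemma submod0 : A 0. Proof. exact: (submodP A).1. Qed.

Lemma submodZ a u : A u -> A (a *: u).
Proof.
by move=> Au; rewrite -[_ *: _]addr0; apply: (submodP A).2 => //;
  apply: submod0.
Qed.

Lemma submodD u v : A u -> A v -> A (u + v).
Proof. by move=> Au Av; rewrite -[u]scale1r; apply: (submodP A).2. Qed.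

Lemma submodN u : A u -> A (- u).
Proof. by rewrite -scaleN1r; apply: submodZ. Qed.

Lemma submodB u v : A u -> A v -> A (u - v).
Proof. by move=> Au Av; apply: submodD => //; apply: submodN. Qed.

Definition submod_rel : rel V := fun u v => `[< A (u - v) >].

Lemma submod_rel_equiv : equiv_class_of submod_rel.
Proof.
split=> [u|u v|v u w].
- by apply/asboolP; rewrite subrr; apply: submod0.
- by apply/asboolP/asboolP => /submodN; rewrite opprB.
- move=> /asboolP uv /asboolP vw; apply/asboolP.
  by have := submodD uv vw; rewrite addrA subrK.
Qed.

Canonical submod_equiv : equiv_rel V := EquivRelPack submod_rel_equiv.

Definition quotmod := {eq_quot submod_equiv}.
HB.instance Definition _ := Choice.on quotmod.
HB.instance Definition _ := EqQuotient.on quotmod.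

Lemma quotmod_ind (P : quotmod -> Prop) :
  (forall u, P (\pi_quotmod u)) -> forall x, P x.
Proof. by move=> Ppi x; rewrite -[x]reprK. Qed.

Lemma quotmodP (u v : V) : \pi_quotmod u = \pi_quotmod v <-> A (u - v).
Proof. by split=> [/eqmodP/asboolP//|uv]; apply/eqmodP/asboolP. Qed.

Lemma repr_pi (u : V) : A (repr (\pi_quotmod u) - u).
Proof. by apply/quotmodP; rewrite reprK. Qed.

Definition quotmod_zero : quotmod := \pi_quotmod 0.
Definition quotmod_opp (x : quotmod) : quotmod := \pi_quotmod (- repr x).
Definition quotmod_add (x y : quotmod) : quotmod :=
  \pi_quotmod (repr x + repr y).
Definition quotmod_scale (a : K) (x : quotmod) : quotmod :=
  \pi_quotmod (a *: repr x).

Lemma quotmod_piN u : quotmod_opp (\pi_quotmod u) = \pi_quotmod (- u).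
Proof. by apply/quotmodP; rewrite -opprD; apply/submodN/repr_pi. Qed.

Lemma quotmod_piD u v :
  quotmod_add (\pi_quotmod u) (\pi_quotmod v) = \pi_quotmod (u + v).
Proof.
by apply/quotmodP; rewrite opprD addrACA; apply/submodD; apply/repr_pi.
Qed.

Lemma quotmod_piZ a u : quotmod_scale a (\pi_quotmod u) = \pi_quotmod (a *: u).
Proof. by apply/quotmodP; rewrite -scalerBr; apply/submodZ/repr_pi. Qed.

Lemma quotmod_addA : associative quotmod_add.
Proof.
move=> x y z; elim/quotmod_ind: x => x; elim/quotmod_ind: y => y;
  elim/quotmod_ind: z => z.
by rewrite !quotmod_piD addrA.
Qed.

Lemma quotmod_addC : commutative quotmod_add.
Proof.
by move=> x y; elim/quotmod_ind: x => x; elim/quotmod_ind: y => y;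
  rewrite !quotmod_piD addrC.
Qed.

Lemma quotmod_add0 : left_id quotmod_zero quotmod_add.
Proof. by move=> x; elim/quotmod_ind: x => x; rewrite !quotmod_piD add0r. Qed.

Lemma quotmod_addN : left_inverse quotmod_zero quotmod_opp quotmod_add.
Proof.
by move=> x; elim/quotmod_ind: x => x; rewrite quotmod_piN quotmod_piD addNr.
Qed.

HB.instance Definition _ := GRing.isZmodule.Build quotmod
  quotmod_addA quotmod_addC quotmod_add0 quotmod_addN.

Lemma quotmod_addE (x y : quotmod) : x + y = quotmod_add x y.
Proof. by []. Qed.

Lemma quotmod_scaleA a b x :
  quotmod_scale a (quotmod_scale b x) = quotmod_scale (a * b) x.
Proof. by elim/quotmod_ind: x => x; rewrite !quotmod_piZ scalerA. Qed.

Lemma quotmod_scale1 : left_id 1 quotmod_scale.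
Proof. by move=> x; elim/quotmod_ind: x => x; rewrite quotmod_piZ scale1r. Qed.

Lemma quotmod_scaleDr : right_distributive quotmod_scale +%R.
Proof.
move=> a x y; elim/quotmod_ind: x => x; elim/quotmod_ind: y => y.
by rewrite !quotmod_addE quotmod_piD !quotmod_piZ quotmod_piD scalerDr.
Qed.

Lemma quotmod_scaleDl x : {morph quotmod_scale^~ x : a b / a + b}.
Proof.
elim/quotmod_ind: x => x a b /=.
by rewrite !quotmod_piZ [RHS]quotmod_piD scalerDl.
Qed.

HB.instance Definition _ := GRing.Zmodule_isLmodule.Build K quotmod
  quotmod_scaleA quotmod_scale1 quotmod_scaleDr quotmod_scaleDl.

Lemma quotmod_pi_linear : linear (\pi_quotmod : V -> quotmod).
Proof.
by move=> a u v; rewrite [_ *: _ :> quotmod]quotmod_piZ [RHS]quotmod_piD.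
Qed.

End SubmodTheory.

HB.mixin Record isLieAlgebra (K : fieldType) L of GRing.Lmodule K L := {
  lie : L -> L -> L;
  lie_bilinear : bilinear_for *:%R *:%R lie;
  liexx : forall x, lie x x = 0;
  lie_jacobi : forall x y z,
    lie x (lie y z) + lie y (lie z x) + lie z (lie x y) = 0 }.

#[short(type="lieAlgType")]
HB.structure Definition LieAlgebra (K : fieldType) :=
  { L of GRing.Lmodule K L & isLieAlgebra K L }.

Section LieBasics.
Variables (K : fieldType) (L : lieAlgType K).
Implicit Types x y z : L.

Lemma lieDl x y z : lie (x + y) z = lie x z + lie y z.
Proof. by have := (@lie_bilinear K L).1 z 1 x y; rewrite /= !scale1r. Qed.

Lemma lieDr x y z : lie x (y + z) = lie x y + lie x z.
Proof. by have := (@lie_bilinear K L).2 x 1 y z; rewrite /= !scale1r. Qed.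

Lemma lie0l z : lie 0 z = 0.
Proof. by apply: (addrI (lie 0 z)); rewrite -lieDl !addr0. Qed.

Lemma lie0r z : lie z 0 = 0.
Proof. by apply: (addrI (lie z 0)); rewrite -lieDr !addr0. Qed.

Lemma lieZl a x y : lie (a *: x) y = a *: lie x y.
Proof. by have := (@lie_bilinear K L).1 y a x 0; rewrite /= lie0l !addr0. Qed.

Lemma lieZr a x y : lie x (a *: y) = a *: lie x y.
Proof. by have := (@lie_bilinear K L).2 x a y 0; rewrite /= lie0r !addr0. Qed.

Lemma lieBl x y z : lie (x - y) z = lie x z - lie y z.
Proof. by rewrite lieDl -scaleN1r lieZl scaleN1r. Qed.

Lemma lieBr x y z : lie x (y - z) = lie x y - lie x z.
Proof. by rewrite lieDr -scaleN1r lieZr scaleN1r. Qed.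

Lemma lieC x y : lie y x = - lie x y.
Proof.
apply/eqP; rewrite -addr_eq0 addrC; apply/eqP.
by have := liexx (x + y); rewrite lieDl !lieDr !liexx add0r addr0.
Qed.

End LieBasics.

Section LieMorphisms.
Variables (K : fieldType) (L M : lieAlgType K).

Definition lie_hom : set (L -> M) :=
  [set f | linear f /\ {morph f : x y / lie x y}].

Definition lie_iso : set (L -> M) := [set f | lie_hom f /\ bijective f].

End LieMorphisms.

Definition lie_aut (K : fieldType) (L : lieAlgType K) : set (L -> L) :=
  @lie_iso K L L.

Record lie_ideal (K : fieldType) (L : lieAlgType K) := LieIdeal {
  ideal_submod :> submod L;
  idealP : forall x y, ideal_submod x -> ideal_submod (lie x y) }.

Definition quotlie (K : fieldType) (L : lieAlgType K) (I : lie_ideal L) :=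
  quotmod I.

Section QuotLie.
Variables (K : fieldType) (L : lieAlgType K) (I : lie_ideal L).

HB.instance Definition _ := GRing.Lmodule.on (quotlie I).
HB.instance Definition _ := EqQuotient.on (quotlie I).

Lemma ideal_lier x y : I y -> I (lie x y).
Proof. by move=> Iy; rewrite lieC; apply/submodN/idealP. Qed.

Definition quotlie_lie (x y : quotlie I) : quotlie I :=
  \pi_(quotlie I) (lie (repr x) (repr y)).

Lemma quotlie_piE (u v : L) :
  quotlie_lie (\pi_(quotlie I) u) (\pi_(quotlie I) v)
   = \pi_(quotlie I) (lie u v).
Proof.
apply/quotmodP; set u' := repr _; set v' := repr _.
have -> : lie u' v' - lie u v = lie (u' - u) v' + lie u (v' - v).
  by rewrite lieBl lieBr addrA subrK.
by apply: submodD; [apply: idealP|apply: ideal_lier]; apply: repr_pi.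
Qed.

Lemma quotlie_ind (P : quotlie I -> Prop) :
  (forall u, P (\pi_(quotlie I) u)) -> forall x, P x.
Proof. exact: quotmod_ind. Qed.

Lemma quotlie_piD (u v : L) :
  \pi_(quotlie I) u + \pi_(quotlie I) v = \pi_(quotlie I) (u + v).
Proof. exact: quotmod_piD. Qed.

Lemma quotlie_piZ a (u : L) :
  a *: \pi_(quotlie I) u = \pi_(quotlie I) (a *: u).
Proof. exact: quotmod_piZ. Qed.

Lemma quotlie_lie_linearl z a x y :
  quotlie_lie (a *: x + y) z = a *: quotlie_lie x z + quotlie_lie y z.
Proof.
elim/quotlie_ind: x => x; elim/quotlie_ind: y => y.
elim/quotlie_ind: z => z; rewrite quotlie_piZ quotlie_piD !quotlie_piE.
by rewrite quotlie_piZ quotlie_piD lieDl lieZl.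
Qed.

Lemma quotlie_lie_linearr z a x y :
  quotlie_lie z (a *: x + y) = a *: quotlie_lie z x + quotlie_lie z y.
Proof.
elim/quotlie_ind: x => x; elim/quotlie_ind: y => y.
elim/quotlie_ind: z => z; rewrite quotlie_piZ quotlie_piD !quotlie_piE.
by rewrite quotlie_piZ quotlie_piD lieDr lieZr.
Qed.

Lemma quotlie_bilinear : bilinear_for *:%R *:%R quotlie_lie.
Proof.
split=> z a x y; [exact: quotlie_lie_linearl|exact: quotlie_lie_linearr].
Qed.

Lemma quotlie_xx x : quotlie_lie x x = 0.
Proof. by elim/quotlie_ind: x => x; rewrite quotlie_piE liexx. Qed.

Lemma quotlie_jacobi x y z :
  quotlie_lie x (quotlie_lie y z) + quotlie_lie y (quotlie_lie z x)
  + quotlie_lie z (quotlie_lie x y) = 0.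
Proof.
elim/quotlie_ind: x => x; elim/quotlie_ind: y => y; elim/quotlie_ind: z => z.
by rewrite !quotlie_piE !quotlie_piD lie_jacobi.
Qed.

HB.instance Definition _ := isLieAlgebra.Build K (quotlie I)
  quotlie_bilinear quotlie_xx quotlie_jacobi.

End QuotLie.

Section LowerCentralSeries.
Variables (K : fieldType) (L : lieAlgType K).

Definition lie_set (A B : set L) : set L :=
  linspan [set lie x y | x in A & y in B].

(* Indexed so that [lcs i] is L^i for i >= 1, with L^1 = L; [lcs 0] is a
   dummy value. *)
Fixpoint lcs (i : nat) : set L :=
  if i is j.+1 then (if j is 0%N then setT else lie_set (lcs j) setT)
  else setT.

Lemma lcs_submod i : is_submod (lcs i).
Proof.
by case: i => [|[|i]]; [split|split|apply: linspan_submod].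
Qed.

Definition lcs_sub i : submod L := Submod (lcs_submod i).

Lemma lcs_sub_ideal i x y : lcs_sub i x -> lcs_sub i (lie x y).
Proof.
elim: i x y => [//|[//|i] IH] x y Lx.
rewrite /=; apply: sub_gen_smallest; exists x; last by exists y.
suff : lie_set (lcs i.+1) setT `<=` lcs i.+1 by apply.
apply: smallest_sub; first exact: lcs_submod.
by move=> _ [u Lu [v _ <-]]; apply: IH.
Qed.

Definition lcs_ideal i : lie_ideal L := LieIdeal (@lcs_sub_ideal i).

Definition nilpotent_of_step (t : nat) : Prop :=
  lcs t.+1 = [set 0] /\ lcs t <> [set 0].

End LowerCentralSeries.

Definition has_dim (K : fieldType) (V : lmodType K) (d : nat) : Prop :=
  exists f : V -> 'rV[K]_d, linear f /\ bijective f.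

Definition has_type (K : fieldType) (L : lieAlgType K) (d : nat) : Prop :=
  has_dim (quotlie (lcs_ideal L 2)) d.

(* FL(d) is the initial Lie algebra with d marked elements: formal Lie
   expressions in d letters, modulo the congruence generated by the axioms of
   Lie algebras over K. Its universal property is [freeLie_universal]. *)

Inductive lterm (K : fieldType) (d : nat) : Type :=
| LGen of 'I_d
| LZero
| LOpp of lterm K d
| LAdd of lterm K d & lterm K d
| LScale of K & lterm K d
| LLie of lterm K d & lterm K d.
Arguments LGen {K d}.
Arguments LZero {K d}.

HB.instance Definition _ (K : fieldType) d := gen_eqMixin (lterm K d).
HB.instance Definition _ (K : fieldType) d := gen_choiceMixin (lterm K d).

Section FreeLie.
Variables (K : fieldType) (d : nat).

Inductive lterm_eq : lterm K d -> lterm K d -> Prop :=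
| Lrefl x : lterm_eq x x
| Lsym x y : lterm_eq x y -> lterm_eq y x
| Ltrans x y z : lterm_eq x y -> lterm_eq y z -> lterm_eq x z
| LoppE x x' : lterm_eq x x' -> lterm_eq (LOpp x) (LOpp x')
| LaddE x x' y y' :
    lterm_eq x x' -> lterm_eq y y' -> lterm_eq (LAdd x y) (LAdd x' y')
| LscaleE a x x' : lterm_eq x x' -> lterm_eq (LScale a x) (LScale a x')
| LlieE x x' y y' :
    lterm_eq x x' -> lterm_eq y y' -> lterm_eq (LLie x y) (LLie x' y')
| LaddA x y z : lterm_eq (LAdd x (LAdd y z)) (LAdd (LAdd x y) z)
| LaddC x y : lterm_eq (LAdd x y) (LAdd y x)
| Ladd0 x : lterm_eq (LAdd LZero x) x
| LaddN x : lterm_eq (LAdd (LOpp x) x) LZero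
| LscaleA a b x : lterm_eq (LScale a (LScale b x)) (LScale (a * b) x)
| Lscale1 x : lterm_eq (LScale 1 x) x
| LscaleDr a x y :
    lterm_eq (LScale a (LAdd x y)) (LAdd (LScale a x) (LScale a y))
| LscaleDl a b x :
    lterm_eq (LScale (a + b) x) (LAdd (LScale a x) (LScale b x))
| LlieDl x y z : lterm_eq (LLie (LAdd x y) z) (LAdd (LLie x z) (LLie y z))
| LlieDr x y z : lterm_eq (LLie x (LAdd y z)) (LAdd (LLie x y) (LLie x z))
| LlieZl a x y : lterm_eq (LLie (LScale a x) y) (LScale a (LLie x y))
| LlieZr a x y : lterm_eq (LLie x (LScale a y)) (LScale a (LLie x y))
| Lliexx x : lterm_eq (LLie x x) LZero
| Ljacobi x y z :
    lterm_eq (LAdd (LAdd (LLie x (LLie y z)) (LLie y (LLie z x)))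
                   (LLie z (LLie x y))) LZero.

Definition lterm_rel : rel (lterm K d) := fun x y => `[< lterm_eq x y >].

Lemma lterm_rel_equiv : equiv_class_of lterm_rel.
Proof.
split=> [x|x y|y x z].
- by apply/asboolP; apply: Lrefl.
- by apply/asboolP/asboolP; apply: Lsym.
- by move=> /asboolP xy /asboolP yz; apply/asboolP; apply: Ltrans xy yz.
Qed.

Canonical lterm_equiv : equiv_rel (lterm K d) := EquivRelPack lterm_rel_equiv.

Definition freeLie := {eq_quot lterm_equiv}.
HB.instance Definition _ := Choice.on freeLie.
HB.instance Definition _ := EqQuotient.on freeLie.

Lemma freeLie_ind (P : freeLie -> Prop) :
  (forall u, P (\pi_freeLie u)) -> forall x, P x.
Proof. by move=> Ppi x; rewrite -[x]reprK. Qed.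

Lemma freeLieP x y : \pi_freeLie x = \pi_freeLie y <-> lterm_eq x y.
Proof. by split=> [/eqmodP/asboolP//|xy]; apply/eqmodP/asboolP. Qed.

Lemma freeLie_repr x : lterm_eq (repr (\pi_freeLie x)) x.
Proof. by apply/freeLieP; rewrite reprK. Qed.

Definition freeLie_gen (i : 'I_d) : freeLie := \pi_freeLie (LGen i).
Definition freeLie_zero : freeLie := \pi_freeLie LZero.
Definition freeLie_opp (x : freeLie) : freeLie := \pi_freeLie (LOpp (repr x)).
Definition freeLie_add (x y : freeLie) : freeLie :=
  \pi_freeLie (LAdd (repr x) (repr y)).
Definition freeLie_scale (a : K) (x : freeLie) : freeLie :=
  \pi_freeLie (LScale a (repr x)).
Definition freeLie_lie (x y : freeLie) : freeLie :=
  \pi_freeLie (LLie (repr x) (repr y)).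

Lemma freeLie_piN x : freeLie_opp (\pi_freeLie x) = \pi_freeLie (LOpp x).
Proof. by apply/freeLieP/LoppE/freeLie_repr. Qed.

Lemma freeLie_piD x y :
  freeLie_add (\pi_freeLie x) (\pi_freeLie y) = \pi_freeLie (LAdd x y).
Proof. by apply/freeLieP/LaddE; apply/freeLie_repr. Qed.

Lemma freeLie_piZ a x :
  freeLie_scale a (\pi_freeLie x) = \pi_freeLie (LScale a x).
Proof. by apply/freeLieP/LscaleE/freeLie_repr. Qed.

Lemma freeLie_piL x y :
  freeLie_lie (\pi_freeLie x) (\pi_freeLie y) = \pi_freeLie (LLie x y).
Proof. by apply/freeLieP/LlieE; apply/freeLie_repr. Qed.

Lemma freeLie_addA : associative freeLie_add.
Proof.
move=> x y z; elim/freeLie_ind: x => x; elim/freeLie_ind: y => y;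
  elim/freeLie_ind: z => z.
rewrite !freeLie_piD.
exact/freeLieP/LaddA.
Qed.

Lemma freeLie_addC : commutative freeLie_add.
Proof.
by move=> x y; elim/freeLie_ind: x => x; elim/freeLie_ind: y => y;
  rewrite !freeLie_piD; apply/freeLieP/LaddC.
Qed.

Lemma freeLie_add0 : left_id freeLie_zero freeLie_add.
Proof.
by move=> x; elim/freeLie_ind: x => x; rewrite !freeLie_piD;
  apply/freeLieP/Ladd0.
Qed.

Lemma freeLie_addN : left_inverse freeLie_zero freeLie_opp freeLie_add.
Proof.
by move=> x; elim/freeLie_ind: x => x; rewrite freeLie_piN freeLie_piD;
  apply/freeLieP/LaddN.
Qed.

HB.instance Definition _ := GRing.isZmodule.Build freeLie
  freeLie_addA freeLie_addC freeLie_add0 freeLie_addN.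

Lemma freeLie_addE (x y : freeLie) : x + y = freeLie_add x y.
Proof. by []. Qed.

Lemma freeLie_scaleA a b x :
  freeLie_scale a (freeLie_scale b x) = freeLie_scale (a * b) x.
Proof.
by elim/freeLie_ind: x => x; rewrite !freeLie_piZ; apply/freeLieP/LscaleA.
Qed.

Lemma freeLie_scale1 : left_id 1 freeLie_scale.
Proof.
by move=> x; elim/freeLie_ind: x => x; rewrite freeLie_piZ;
  apply/freeLieP/Lscale1.
Qed.

Lemma freeLie_scaleDr : right_distributive freeLie_scale +%R.
Proof.
move=> a x y; elim/freeLie_ind: x => x; elim/freeLie_ind: y => y.
rewrite !freeLie_addE freeLie_piD !freeLie_piZ freeLie_piD.
exact/freeLieP/LscaleDr.
Qed.

Lemma freeLie_scaleDl x : {morph freeLie_scale^~ x : a b / a + b}.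
Proof.
elim/freeLie_ind: x => x a b /=; rewrite !freeLie_piZ [RHS]freeLie_piD.
exact/freeLieP/LscaleDl.
Qed.

HB.instance Definition _ := GRing.Zmodule_isLmodule.Build K freeLie
  freeLie_scaleA freeLie_scale1 freeLie_scaleDr freeLie_scaleDl.

Lemma freeLie_scaleE a (x : freeLie) : a *: x = freeLie_scale a x.
Proof. by []. Qed.

Lemma freeLie_lie_linearl z a x y :
  freeLie_lie (a *: x + y) z = a *: freeLie_lie x z + freeLie_lie y z.
Proof.
elim/freeLie_ind: x => x; elim/freeLie_ind: y => y.
elim/freeLie_ind: z => z; rewrite !freeLie_addE !freeLie_scaleE.
rewrite freeLie_piZ freeLie_piD !freeLie_piL freeLie_piZ freeLie_piD.
apply/freeLieP.
exact: Ltrans (LlieDl _ _ _) (LaddE (LlieZl _ _ _) (Lrefl _)).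
Qed.

Lemma freeLie_lie_linearr z a x y :
  freeLie_lie z (a *: x + y) = a *: freeLie_lie z x + freeLie_lie z y.
Proof.
elim/freeLie_ind: x => x; elim/freeLie_ind: y => y.
elim/freeLie_ind: z => z; rewrite !freeLie_addE !freeLie_scaleE.
rewrite freeLie_piZ freeLie_piD !freeLie_piL freeLie_piZ freeLie_piD.
apply/freeLieP.
exact: Ltrans (LlieDr _ _ _) (LaddE (LlieZr _ _ _) (Lrefl _)).
Qed.

Lemma freeLie_bilinear : bilinear_for *:%R *:%R freeLie_lie.
Proof.
split=> z a x y; [exact: freeLie_lie_linearl|exact: freeLie_lie_linearr].
Qed.

Lemma freeLie_xx x : freeLie_lie x x = 0.
Proof.
by elim/freeLie_ind: x => x; rewrite freeLie_piL; apply/freeLieP/Lliexx.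
Qed.

Lemma freeLie_jacobi x y z :
  freeLie_lie x (freeLie_lie y z) + freeLie_lie y (freeLie_lie z x)
  + freeLie_lie z (freeLie_lie x y) = 0.
Proof.
elim/freeLie_ind: x => x; elim/freeLie_ind: y => y; elim/freeLie_ind: z => z.
rewrite !freeLie_addE; rewrite !freeLie_piL.
rewrite !freeLie_piD; exact/freeLieP/Ljacobi.
Qed.

HB.instance Definition _ := isLieAlgebra.Build K freeLie
  freeLie_bilinear freeLie_xx freeLie_jacobi.

Section Universal.
Variables (L : lieAlgType K) (g : 'I_d -> L).

Fixpoint lterm_eval (x : lterm K d) : L :=
  match x with
  | LGen i => g i
  | LZero => 0
  | LOpp x => - lterm_eval x
  | LAdd x y => lterm_eval x + lterm_eval y
  | LScale a x => a *: lterm_eval x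
  | LLie x y => lie (lterm_eval x) (lterm_eval y)
  end.

Lemma lterm_eval_eq x y : lterm_eq x y -> lterm_eval x = lterm_eval y.
Proof.
elim=> //=.
- by move=> ? ? ? _ -> _ ->.
- by move=> ? ? _ ->.
- by move=> ? ? ? ? _ -> _ ->.
- by move=> ? ? ? _ ->.
- by move=> ? ? ? ? _ -> _ ->.
- by move=> ? ? ?; rewrite addrA.
- by move=> ? ?; rewrite addrC.
- by move=> ?; rewrite add0r.
- by move=> ?; rewrite addNr.
- by move=> ? ? ?; rewrite scalerA.
- by move=> ?; rewrite scale1r.
- by move=> ? ? ?; rewrite scalerDr.
- by move=> ? ? ?; rewrite scalerDl.
- by move=> ? ? ?; rewrite lieDl.
- by move=> ? ? ?; rewrite lieDr.
- by move=> ? ? ?; rewrite lieZl.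
- by move=> ? ? ?; rewrite lieZr.
- by move=> ?; rewrite liexx.
- by move=> ? ? ?; rewrite lie_jacobi.
Qed.

Definition freeLie_eval (x : freeLie) : L := lterm_eval (repr x).

Lemma freeLie_eval_pi x : freeLie_eval (\pi_freeLie x) = lterm_eval x.
Proof. exact/lterm_eval_eq/freeLie_repr. Qed.

Lemma freeLie_universal : exists! f : freeLie -> L,
  @lie_hom K freeLie L f /\ forall i, f (freeLie_gen i) = g i.
Proof.
exists freeLie_eval; split.
  split; last by move=> i; rewrite freeLie_eval_pi.
  split=> [a|]; move=> x y; elim/freeLie_ind: x => x; elim/freeLie_ind: y => y.
  - rewrite !(freeLie_addE, freeLie_scaleE) freeLie_piZ freeLie_piD.
    by rewrite !freeLie_eval_pi.
  - by rewrite [lie _ _ in LHS]freeLie_piL !freeLie_eval_pi.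
move=> f [[flin fL] fg]; apply/funext; move=> x; elim/freeLie_ind: x => x.
have fD u v : f (u + v) = f u + f v.
  by have := flin 1 u v; rewrite !scale1r.
have f0 : f 0 = 0 by apply: (addrI (f 0)); rewrite -fD !addr0.
have fZ a u : f (a *: u) = a *: f u.
  by have := flin a u 0; rewrite f0 !addr0.
rewrite freeLie_eval_pi.
elim: x => [i||x IHx|x IHx y IHy|a x IHx|x IHx y IHy] /=.
- by rewrite -fg.
- by rewrite -f0.
- by rewrite IHx -scaleN1r -fZ scaleN1r -freeLie_piN.
- by rewrite IHx IHy -fD freeLie_addE freeLie_piD.
- by rewrite IHx -fZ freeLie_scaleE freeLie_piZ.
- by rewrite IHx IHy -fL -freeLie_piL.
Qed.

End Universal.

End FreeLie.

(* n_{d,t} = FL(d) / FL(d)^{t+1} *)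
Definition freeNil (K : fieldType) (d t : nat) : lieAlgType K :=
  quotlie (lcs_ideal (freeLie K d) t.+1).

Section Forms.
Variables (K : fieldType) (L : lieAlgType K).
Implicit Type B : L -> L -> K.

Definition inv_form B : Prop :=
  [/\ bilinear_for *%R *%R B,
      forall x y, B x y = B y x
    & forall x y z, B (lie x y) z = B x (lie y z)].

Definition form_ker B : set L := [set x | forall y, B x y = 0].

Definition twist B (theta : L -> L) : L -> L -> K :=
  fun x y => B (theta x) (theta y).

End Forms.

Record quadLie (K : fieldType) := QuadLie {
  quad_alg :> lieAlgType K;
  quad_form : quad_alg -> quad_alg -> K;
  quad_inv : inv_form quad_form;
  quad_nondeg : form_ker quad_form = [set 0] }.

Definition isometric (K : fieldType) (Q Q' : quadLie K) : Prop :=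
  exists phi : Q -> Q', lie_iso phi /\
    forall x y, quad_form x y = quad_form (phi x) (phi y).

(* The t-nilpotent quadratic Lie algebras of type d. Finite dimensionality is
   not an extra hypothesis: it follows from nilpotency and finite type. *)
Definition nil_quad (K : fieldType) (d t : nat) (Q : quadLie K) : Prop :=
  nilpotent_of_step Q t /\ has_type Q d.

(* Isometry classes are plain predicates, and not members of [set _], because
   [quadLie K] lives in a universe too large for [set]. *)
Definition isometry_class (K : fieldType) (d t : nat) (Q : quadLie K) :
    quadLie K -> Prop :=
  fun Q' => nil_quad d t Q' /\ isometric Q Q'.

Definition isometry_type (K : fieldType) (d t : nat) :=
  {C : quadLie K -> Prop |
     exists Q, nil_quad d t Q /\ C = isometry_class d t Q}.

Record category := Category {
  cobj :> Type;
  chom : cobj -> cobj -> Type;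
  cid : forall X, chom X X;
  ccomp : forall X Y Z, chom Y Z -> chom X Y -> chom X Z;
  ccomp1f : forall X Y (f : chom X Y), ccomp (cid Y) f = f;
  ccompf1 : forall X Y (f : chom X Y), ccomp f (cid X) = f;
  ccompA : forall X Y Z W (f : chom X Y) (g : chom Y Z) (h : chom Z W),
    ccomp h (ccomp g f) = ccomp (ccomp h g) f }.

Definition isomorphic (C : category) (X Y : C) : Prop :=
  exists (f : chom X Y) (g : chom Y X),
    ccomp g f = cid X /\ ccomp f g = cid Y.

Section Sym0.
Variables (K : fieldType) (d t : nat).
Local Notation N := (freeNil K d t).

Definition is_sym0 : set (N -> N -> K) :=
  [set B | [/\ inv_form B, form_ker B `<=` @lcs K N 2
             & ~ (@lcs K N t `<=` form_ker B)]].

Record sym0 := Sym0 {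
  sym0_form :> N -> N -> K;
  sym0P : is_sym0 sym0_form }.

Section Hom.
Variables B1 B2 : sym0.

Definition is_mend : set (N -> N) :=
  [set phi | [/\ lie_hom phi,
                 forall x y, B1 x y = B2 (phi x) (phi y)
               & phi @` form_ker B1 `<=` form_ker B2]].

Record mend := Mend {
  mend_fun :> N -> N;
  mendP : is_mend mend_fun }.

HB.instance Definition _ := gen_eqMixin mend.
HB.instance Definition _ := gen_choiceMixin mend.

Definition mend_rel : rel mend :=
  fun phi1 phi2 => `[< forall x, form_ker B2 (phi1 x - phi2 x) >].

Lemma form_ker_submod : is_submod (form_ker B2).
Proof.
have [[[lin _] _ _] _ _] := sym0P B2.
have B0 y : B2 0 y = 0.
  by have := lin y (-1) 0 0; rewrite /= scaler0 addr0 mulN1r addNr.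
by split=> // a u v Bu Bv y; rewrite (lin y) /= Bu Bv mulr0 addr0.
Qed.

Lemma mend_rel_equiv : equiv_class_of mend_rel.
Proof.
pose S := Submod form_ker_submod.
split=> [f|f g|g f h].
- by apply/asboolP => x; rewrite subrr; apply: (submod0 S).
- by apply/asboolP/asboolP => fg x; have := @submodN _ _ S _ (fg x);
  rewrite opprB.
- move=> /asboolP fg /asboolP gh; apply/asboolP => x.
  by have := @submodD _ _ S _ _ (fg x) (gh x); rewrite /= addrA subrK.
Qed.

Canonical mend_equiv : equiv_rel mend := EquivRelPack mend_rel_equiv.

Definition sym0_hom := {eq_quot mend_equiv}.
HB.instance Definition _ := Choice.on sym0_hom.
HB.instance Definition _ := EqQuotient.on sym0_hom.

Lemma sym0_hom_ind (P : sym0_hom -> Prop) :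
  (forall u, P (\pi_sym0_hom u)) -> forall x, P x.
Proof. by move=> Ppi x; rewrite -[x]reprK. Qed.

Lemma sym0_homP (f g : mend) :
  \pi_sym0_hom f = \pi_sym0_hom g <-> forall x, form_ker B2 (f x - g x).
Proof. by split=> [/eqmodP/asboolP//|fg]; apply/eqmodP/asboolP. Qed.

Lemma mend_repr (f : mend) x : form_ker B2 (repr (\pi_sym0_hom f) x - f x).
Proof. by move: x; apply/sym0_homP; rewrite reprK. Qed.

End Hom.

Lemma mend_id_subproof (B : sym0) : is_mend B B id.
Proof. by split=> // _ [x Bx <-]. Qed.

Definition mend_id (B : sym0) : mend B B := Mend (@mend_id_subproof B).

Lemma mend_comp_subproof (B1 B2 B3 : sym0) (g : mend B2 B3) (f : mend B1 B2) :
  is_mend B1 B3 (g \o f).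
Proof.
have [[flin fL] fB fK] := mendP f; have [[glin gL] gB gK] := mendP g.
split.
- by split=> [a x y|x y] /=; rewrite ?flin ?glin ?fL ?gL.
- by move=> x y; rewrite fB gB.
- by move=> _ [x Bx <-]; apply: gK; exists (f x) => //; apply: fK; exists x.
Qed.

Definition mend_comp (B1 B2 B3 : sym0) (g : mend B2 B3) (f : mend B1 B2) :
  mend B1 B3 := Mend (mend_comp_subproof g f).

Definition sym0_id (B : sym0) : sym0_hom B B := \pi_(sym0_hom B B) (mend_id B).

Definition sym0_comp (B1 B2 B3 : sym0) (g : sym0_hom B2 B3)
    (f : sym0_hom B1 B2) : sym0_hom B1 B3 :=
  \pi_(sym0_hom B1 B3) (mend_comp (repr g) (repr f)).

Lemma sym0_comp_pi (B1 B2 B3 : sym0) (g : mend B2 B3) (f : mend B1 B2) :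
  sym0_comp (\pi_(sym0_hom B2 B3) g) (\pi_(sym0_hom B1 B2) f)
  = \pi_(sym0_hom B1 B3) (mend_comp g f).
Proof.
apply/sym0_homP => x /=; set g' := repr _; set f' := repr _.
have [[glin _] _ gK] := mendP g.
have gB u v : g (u - v) = g u - g v.
  by rewrite addrC -scaleN1r glin scaleN1r addrC.
rewrite -[g' _](subrK (g (f' x))) -addrA -gB.
apply: (@submodD _ _ (Submod (form_ker_submod B3))).
- exact: mend_repr.
- by apply: gK; exists (f' x - f x) => //; apply: mend_repr.
Qed.

Lemma sym0_comp1f (B1 B2 : sym0) (f : sym0_hom B1 B2) :
  sym0_comp (sym0_id B2) f = f.
Proof.
elim/sym0_hom_ind: f => f; rewrite sym0_comp_pi; apply/sym0_homP => x /=.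
by rewrite subrr; apply: (submod0 (Submod (form_ker_submod B2))).
Qed.

Lemma sym0_compf1 (B1 B2 : sym0) (f : sym0_hom B1 B2) :
  sym0_comp f (sym0_id B1) = f.
Proof.
elim/sym0_hom_ind: f => f; rewrite sym0_comp_pi; apply/sym0_homP => x /=.
by rewrite subrr; apply: (submod0 (Submod (form_ker_submod B2))).
Qed.

Lemma sym0_compA (B1 B2 B3 B4 : sym0) (f : sym0_hom B1 B2)
    (g : sym0_hom B2 B3) (h : sym0_hom B3 B4) :
  sym0_comp h (sym0_comp g f) = sym0_comp (sym0_comp h g) f.
Proof.
elim/sym0_hom_ind: f => f; elim/sym0_hom_ind: g => g; elim/sym0_hom_ind: h => h.
rewrite !sym0_comp_pi; apply/sym0_homP => x /=.
by rewrite subrr; apply: (submod0 (Submod (form_ker_submod B4))).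
Qed.

Definition Sym0Cat : category :=
  Category sym0_comp1f sym0_compf1 sym0_compA.

Definition form_orbit (B : N -> N -> K) : set (N -> N -> K) :=
  [set twist B theta | theta in @lie_aut K N].

Definition sym0_orbit :=
  {O : set (N -> N -> K) | exists B, is_sym0 B /\ O = form_orbit B}.

End Sym0.

(* Main.v *)
(** An endomorphism of a nilpotent Lie algebra n that induces the identity on
    n/n^2 moves n^i into n^(i+1), hence is bijective, whatever the dimension of
    n. Since Ker B is contained in n_{d,t}^2, any two morphisms of Sym_0(d,t)
    that are inverse up to ~ are therefore automorphisms, which gives the
    equality of orbits and isomorphism classes. For the classification, send B
    to n_{d,t}/Ker B: isometries between such quotients lift to n_{d,t} by
    freeness, and the lifts of an isometry and of its inverse are bijective by
    the same argument. Conversely, a t-nilpotent quadratic Lie algebra of type d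
    is a quotient of n_{d,t} through lifts of a basis of its abelianization, and
    one pulls its form back. *)

Require Import Defs.
From HB Require Import structures.
From mathcomp Require Import all_boot all_order all_algebra.
From mathcomp Require Import boolp classical_sets functions cardinality.

Set Implicit Arguments.
Unset Strict Implicit.
Unset Printing Implicit Defensive.

Import GRing.Theory.
Local Open Scope classical_set_scope.
Local Open Scope ring_scope.

(** * Bijections and linear functions *)

Lemma inj_surj_bijective (A B : Type) (f : A -> B) :
  injective f -> (forall y, exists x, f x = y) -> bijective f.
Proof.
(* Here [cid] is the choice operator, not the identity of a category. *)
move=> finj fsurj; pose g y := projT1 (cid (fsurj y)).
have fg : cancel g f by move=> y; apply: (projT2 (cid (fsurj y))).
by exists g => // x; apply: finj; rewrite fg.
Qed.

Section LinearFunctions.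
Variables (K : fieldType) (U V : lmodType K) (f : U -> V).
Hypothesis flin : linear f.

Lemma linfunD x y : f (x + y) = f x + f y.
Proof. by have := flin 1 x y; rewrite !scale1r. Qed.

Lemma linfun0 : f 0 = 0.
Proof. by apply: (addrI (f 0)); rewrite -linfunD !addr0. Qed.

Lemma linfunZ a x : f (a *: x) = a *: f x.
Proof. by have := flin a x 0; rewrite linfun0 !addr0. Qed.

Lemma linfunB x y : f (x - y) = f x - f y.
Proof. by rewrite addrC -scaleN1r flin scaleN1r addrC. Qed.

Lemma linfun_inj : (forall x, f x = 0 -> x = 0) -> injective f.
Proof.
move=> f0 x y fxy; apply/eqP; rewrite -subr_eq0; apply/eqP/f0.
by rewrite linfunB fxy subrr.
Qed.

End LinearFunctions.

(** * The lower central series and its behaviour under homomorphisms *)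

Lemma lcs0T (K : fieldType) (L : lieAlgType K) (x : L) : lcs 0 x.
Proof. by []. Qed.

Lemma lcs1T (K : fieldType) (L : lieAlgType K) (x : L) : lcs 1 x.
Proof. by []. Qed.

#[local] Hint Resolve lcs0T lcs1T : core.
#[local] Arguments lcs : simpl never.

Section LowerCentralSeriesSubmod.
Variables (K : fieldType) (L : lieAlgType K) (i : nat).

Lemma lcs0 : @lcs K L i 0.
Proof. exact: (submod0 (lcs_sub L i)). Qed.

Lemma lcs_lin a (u v : L) : lcs i u -> lcs i v -> lcs i (a *: u + v).
Proof. exact: (submodP (lcs_sub L i)).2. Qed.

Lemma lcsD (u v : L) : lcs i u -> lcs i v -> lcs i (u + v).
Proof. exact: (@submodD _ _ (lcs_sub L i)). Qed.

Lemma lcsN (u : L) : lcs i u -> lcs i (- u).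
Proof. exact: (@submodN _ _ (lcs_sub L i)). Qed.

Lemma lcsB (u v : L) : lcs i u -> lcs i v -> lcs i (u - v).
Proof. exact: (@submodB _ _ (lcs_sub L i)). Qed.

End LowerCentralSeriesSubmod.

Section LieHomTheory.
Variables (K : fieldType).
Implicit Types L M P : lieAlgType K.

Lemma lie_hom_comp L M P (f : L -> M) (g : M -> P) :
  lie_hom f -> lie_hom g -> lie_hom (g \o f).
Proof.
move=> [flin fL] [glin gL].
by split=> [a x y|x y] /=; rewrite ?flin ?glin ?fL ?gL.
Qed.

Lemma lie_hom_can L M (f : L -> M) (g : M -> L) :
  lie_hom f -> cancel f g -> cancel g f -> lie_hom g.
Proof.
move=> [flin fL] fK gK; split=> [a x y|x y]; apply: (can_inj fK).
  by rewrite flin !gK.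
by rewrite fL !gK.
Qed.

(** The term is the smallest subspace containing these brackets; this is the induction principle for
    the series. *)
Lemma lcsS_ind L (A : set L) i : is_submod A ->
  (forall x y, lcs i.+1 x -> A (lie x y)) -> @lcs K L i.+2 `<=` A.
Proof.
move=> sA Alie; apply: smallest_sub => // _ [x Lx [y _ <-]]; exact: Alie.
Qed.

Lemma lcs_lie L i (x y : L) : lcs i.+1 x -> lcs i.+2 (lie x y).
Proof. by move=> Lx; apply: sub_gen_smallest; exists x => //; exists y. Qed.

(** By Jacobi, [x, [u, v]] = [[x, u], v] - [[x, v], u], and each of the two successive brackets
    gains a degree. *)
Lemma lcs_lie2 L i (x y : L) : lcs i.+1 x -> lcs 2 y -> lcs i.+3 (lie x y).
Proof.
move=> Lx; apply: (@lcsS_ind _ [set y | lcs i.+3 (lie x y)]).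
  split=> [|a u v] /=; first by rewrite lie0r; apply: lcs0.
  by rewrite lieDr lieZr; apply: lcs_lin.
move=> u v _ /=.
have -> : lie x (lie u v) = lie (lie x u) v - lie (lie x v) u.
  have := lie_jacobi x u v; rewrite (lieC (lie x u) v) (lieC (lie v x) u).
  rewrite (lieC x v) -[- lie x v]scaleN1r lieZl scaleN1r opprK => /eqP.
  by rewrite subr_eq0 => /eqP <-; rewrite addrK.
by apply: lcsB; do 2!apply: lcs_lie.
Qed.

Lemma lie_hom_lcs L M (f : L -> M) i x : lie_hom f -> lcs i x -> lcs i (f x).
Proof.
move=> [flin fL]; case: i => [//|i]; elim: i x => [//|i IH] x.
apply: (@lcsS_ind _ [set x | lcs i.+2 (f x)]); last first.
  by move=> u v Lu /=; rewrite fL; apply: lcs_lie; apply: IH.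
split=> [|a u v] /=; first by rewrite (linfun0 flin); apply: lcs0.
by rewrite flin; apply: lcs_lin.
Qed.

(** Induction lifts the left factor of a bracket within the series, surjectivity lifts the right
    factor anywhere. *)
Lemma lie_hom_lcs_surj L M (f : L -> M) i y :
  lie_hom f -> (forall y, exists x, f x = y) -> lcs i y ->
  exists2 x, lcs i x & f x = y.
Proof.
move=> [flin fL] fsurj.
(* The dummy term of index 0 and L^1 are both all of L, so surjectivity settles them. *)
case: i => [_|i]; first by have [x <-] := fsurj y; exists x.
elim: i y => [y _|i IH y]; first by have [x <-] := fsurj y; exists x.
apply: (@lcsS_ind _ [set y | exists2 x, lcs i.+2 x & f x = y]); last first.
  move=> _ v /IH[x Lx <-]; have [z <-] := fsurj v.
  by exists (lie x z); rewrite ?fL//; apply: lcs_lie.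
split=> [|a _ _ [u Lu <-] [v Lv <-]].
  by exists 0; [apply: lcs0|apply: linfun0].
by exists (a *: u + v); [apply: lcs_lin|apply: flin].
Qed.

(** Successive corrections of x push the error y - f x down the series until it reaches M^(t+1) =
    0. *)
Lemma nilpotent_hom_surj L M (f : L -> M) t : lie_hom f ->
  @lcs K M t.+1 = [set 0] -> (forall y, exists x, lcs 2 (y - f x)) ->
  forall y, exists x, f x = y.
Proof.
move=> [flin fL] Mt gen.
(* [u, v] = f [a, b] + [u - f a, f b] + [u, v - f b] *)
have step i y : lcs i.+1 y -> exists x, lcs i.+2 (y - f x).
  elim: i y => [//|i IH] y.
  apply: (@lcsS_ind _ [set y | exists x, lcs i.+3 (y - f x)]); last first.
    move=> u v Lu; have [a La] := IH _ Lu; have [b Lb] := gen v.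
    exists (lie a b).
    have -> : lie u v - f (lie a b) = lie (u - f a) (f b) + lie u (v - f b).
      by rewrite fL lieBl lieBr [RHS]addrC subrKA.
    by apply: lcsD; [apply: lcs_lie|apply: lcs_lie2].
  split=> [|a u v [u' Lu] [v' Lv]].
    by exists 0; rewrite (linfun0 flin) subrr; apply: lcs0.
  exists (a *: u' + v'); rewrite flin opprD addrACA -scalerBr.
  exact: lcs_lin.
have gens i y : exists x, lcs i.+1 (y - f x).
  elim: i => [|i [x /step[z]]]; first by exists 0.
  by rewrite -addrA -opprD -(linfunD flin); exists (x + z).
move=> y; have [x] := gens t y; rewrite Mt => /eqP; rewrite subr_eq0 => /eqP->.
by exists x.
Qed.

(** Surjectivity is the approximation argument started at x = y; injectivity holds because f - id
    raises the degree. *)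
Lemma nilpotent_unipotent_bij L (f : L -> L) t : lie_hom f ->
  @lcs K L t.+1 = [set 0] -> (forall x, lcs 2 (f x - x)) -> bijective f.
Proof.
move=> fhom Lt f1; have [flin fL] := fhom.
apply: inj_surj_bijective; last first.
  apply: nilpotent_hom_surj fhom Lt _ => y; exists y.
  by rewrite -opprB; apply: lcsN.
apply: (linfun_inj flin) => x fx0.
have step i y : lcs i.+1 y -> lcs i.+2 (f y - y).
  elim: i y => [//|i IH] y.
  apply: (@lcsS_ind _ [set y | lcs i.+3 (f y - y)]); last first.
    move=> u v Lu /=.
    (* The first bracket gains a degree by induction on u, the second because f v - v lies in
       L^2. *)
    have -> : f (lie u v) - lie u v = lie (f u - u) (f v) + lie u (f v - v).
      by rewrite fL lieBl lieBr subrKA.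
    by apply: lcsD;
      [apply: lcs_lie; apply: IH|apply: lcs_lie2].
  split=> [|a u v] /=.
    by rewrite (linfun0 flin) subrr; apply: lcs0.
  rewrite flin opprD addrACA -scalerBr.
  exact: lcs_lin.
(* As f x = 0, f x - x is -x: if x lies in one term, it lies in the next. *)
have : lcs t.+1 x.
  elim: t {Lt} => [//|i /step]; rewrite fx0 sub0r => /lcsN.
  by rewrite opprK.
by rewrite Lt.
Qed.

(** Both composites are bijective by the unipotent case: one gives injectivity of f, the other
    surjectivity. *)
Lemma inverse_mod_lcs2_bij L M (f : L -> M) (g : M -> L) t :
  lie_hom f -> lie_hom g ->
  @lcs K L t.+1 = [set 0] -> @lcs K M t.+1 = [set 0] ->
  (forall x, lcs 2 (g (f x) - x)) -> (forall y, lcs 2 (f (g y) - y)) ->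
  bijective f.
Proof.
move=> fh gh Lt Mt gf fg.
have [h1 h1K _] := nilpotent_unipotent_bij (lie_hom_comp fh gh) Lt gf.
have [h2 _ h2K] := nilpotent_unipotent_bij (lie_hom_comp gh fh) Mt fg.
apply: inj_surj_bijective => [|y]; last by exists (g (h2 y)); apply: h2K.
by move=> x y fxy; apply: (can_inj h1K); rewrite /= fxy.
Qed.

End LieHomTheory.

(** * Quotients by ideals and factorization of maps *)

Section QuotientHom.
Variables (K : fieldType) (L : lieAlgType K) (I : lie_ideal L).

Definition lie_pi (x : L) : quotlie I := \pi_(quotlie I)%qT x.

Lemma lie_pi_hom : lie_hom lie_pi.
Proof.
split; first exact: quotmod_pi_linear.
by move=> x y; rewrite [RHS]quotlie_piE.
Qed.

Lemma lie_pi_surj y : exists x, lie_pi x = y.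
Proof. by elim/quotlie_ind: y => x; exists x. Qed.

Lemma lie_piP x y : lie_pi x = lie_pi y <-> I (x - y).
Proof. exact: quotmodP. Qed.

Lemma lie_pi_eq0 x : lie_pi x = 0 <-> I x.
Proof. by rewrite -(linfun0 lie_pi_hom.1) lie_piP subr0. Qed.

(** The factor evaluates f on a chosen representative; as f vanishes on I, the choice is
    immaterial. *)
Lemma quot_linear_factor (V : lmodType K) (f : L -> V) : linear f ->
  (forall x, I x -> f x = 0) ->
  exists g : quotlie I -> V, linear g /\ forall x, g (lie_pi x) = f x.
Proof.
move=> flin fI; exists (fun y => f (repr y)).
have fpi x : f (repr (lie_pi x)) = f x.
  apply/eqP; rewrite -subr_eq0 -(linfunB flin); apply/eqP/fI.
  exact: (repr_pi I x).
split=> // a x y; have [u <-] := lie_pi_surj x; have [v <-] := lie_pi_surj y.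
by rewrite -lie_pi_hom.1 !fpi flin.
Qed.

Lemma quot_lie_factor (M : lieAlgType K) (f : L -> M) : lie_hom f ->
  (forall x, I x -> f x = 0) ->
  exists g : quotlie I -> M, lie_hom g /\ forall x, g (lie_pi x) = f x.
Proof.
move=> [flin fL] /(quot_linear_factor flin)[g [glin gpi]].
exists g; split=> //; split=> // x y.
have [u <-] := lie_pi_surj x; have [v <-] := lie_pi_surj y.
by rewrite -lie_pi_hom.2 !gpi fL.
Qed.

End QuotientHom.

(** Coordinates on L itself replace the quotient L/L^2, so that they can be composed with
    homomorphisms into L. *)
Lemma has_typeP (K : fieldType) (L : lieAlgType K) (d : nat) :
  has_type L d <-> exists c : L -> 'rV[K]_d,
    [/\ linear c, forall v, exists x, c x = v & forall x, c x = 0 <-> lcs 2 x].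
Proof.
split=> [[f [flin [g fK gK]]]|[c [clin csurj c0]]].
  exists (f \o @lie_pi _ _ (lcs_ideal L 2)); split.
  - by move=> a x y /=; rewrite (lie_pi_hom (lcs_ideal L 2)).1 flin.
  - by move=> v; have [x xE] := lie_pi_surj (g v); exists x; rewrite /= xE gK.
  move=> x; rewrite -[lcs 2 x]/(lcs_ideal L 2 x) -lie_pi_eq0 /=.
  split=> [|->]; last by rewrite (linfun0 flin).
  by rewrite -(linfun0 flin) => /(can_inj fK).
have [f [flin fpi]] :=
  quot_linear_factor (I := lcs_ideal L 2) clin (fun x => (c0 x).2).
exists f; split=> //; apply: inj_surj_bijective => [|v].
  apply: (linfun_inj flin) => x; have [u <-] := lie_pi_surj x.
  by rewrite fpi c0 lie_pi_eq0.
by have [x <-] := csurj v; exists (lie_pi _ x).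
Qed.

(** * Vector spaces as abelian Lie algebras *)

Definition abelianLie (K : fieldType) (V : lmodType K) : Type := V.

Section AbelianLie.
Variables (K : fieldType) (V : lmodType K).

HB.instance Definition _ := GRing.Lmodule.on (abelianLie V).

(** With the zero bracket, row vectors become a target for the universal property, which yields
    coordinates on the abelianization. *)
Definition abelian_lie (x y : abelianLie V) : abelianLie V := 0.

Lemma abelian_lie_bilinear : bilinear_for *:%R *:%R abelian_lie.
Proof. by split=> z a x y; rewrite /= addr0 scaler0. Qed.

Lemma abelian_lie_jacobi x y z :
  abelian_lie x (abelian_lie y z) + abelian_lie y (abelian_lie z x)
  + abelian_lie z (abelian_lie x y) = 0.
Proof. by rewrite /abelian_lie !addr0. Qed.

HB.instance Definition _ := isLieAlgebra.Build K (abelianLie V)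
  abelian_lie_bilinear (fun=> erefl) abelian_lie_jacobi.

Lemma abelian_lieE (x y : abelianLie V) : lie x y = 0.
Proof. by []. Qed.

Lemma abelian_lcs i : @lcs K (abelianLie V) i.+2 = [set 0].
Proof.
apply/seteqP; split=> [|_ ->]; last exact: lcs0.
apply: lcsS_ind => [|x y _]; last exact: abelian_lieE.
by split=> // a _ _ -> ->; rewrite /= addr0 scaler0.
Qed.

End AbelianLie.

(** * The free nilpotent Lie algebra: freeness, abelianization, lifting *)

Section FreeNilpotent.
Variables (K : fieldType) (d t : nat).
Local Notation N := (freeNil K d t).
Local Notation nil_ideal := (lcs_ideal (freeLie K d) t.+1).

Definition freeNil_gen (i : 'I_d) : N := lie_pi nil_ideal (freeLie_gen K i).

Lemma freeNil_nilpotent : @lcs K N t.+1 = [set 0].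
Proof.
apply/seteqP; split=> [y|_ ->]; last exact: lcs0.
move=> /(lie_hom_lcs_surj (lie_pi_hom nil_ideal) (lie_pi_surj (I := _))).
by move=> [x Lx <-]; apply/lie_pi_eq0.
Qed.

(** Every element is the class of a formal Lie expression in the generators, and the induction runs
    over that expression. *)
Lemma freeNil_ind (A : set N) : is_submod A -> (forall i, A (freeNil_gen i)) ->
  (forall x y, A x -> A y -> A (lie x y)) -> forall x, A x.
Proof.
move=> sA Agen Alie x; pose S := Submod sA.
have [{}x <-] := lie_pi_surj x; elim/freeLie_ind: x => x.
have [plin pL] := lie_pi_hom nil_ideal.
elim: x => [i||x Ax|x Ax y Ay|a x Ax|x Ax y Ay].
- exact: Agen.
- rewrite -[(\pi_(freeLie K d) LZero)%qT]/(0 : freeLie K d) (linfun0 plin).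
  exact: sA.1.
- rewrite -freeLie_piN -[freeLie_opp _]/(- (\pi_(freeLie K d) x)%qT) -sub0r.
  by rewrite (linfunB plin) (linfun0 plin) sub0r; apply: (submodN (A := S)).
- rewrite -freeLie_piD -freeLie_addE (linfunD plin).
  exact: (submodD (A := S)).
- rewrite -freeLie_piZ -freeLie_scaleE (linfunZ plin).
  exact: (submodZ (A := S)).
- rewrite -freeLie_piL -[freeLie_lie _ _]/(lie (\pi_(freeLie K d) x)%qT
    (\pi_(freeLie K d) y)%qT) pL.
  exact: Alie.
Qed.

(** The map from FL(d) sends FL(d)^(t+1) into L^(t+1) = 0, so it descends. *)
Lemma freeNil_universal (L : lieAlgType K) (g : 'I_d -> L) :
  @lcs K L t.+1 = [set 0] ->
  exists f : N -> L, lie_hom f /\ forall i, f (freeNil_gen i) = g i.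
Proof.
move=> Lt; have [f [[fhom fg] _]] := freeLie_universal g.
have [|h [hhom hpi]] := quot_lie_factor (I := nil_ideal) fhom.
  by move=> x Lx; have := lie_hom_lcs fhom Lx; rewrite Lt.
by exists h; split=> // i; rewrite hpi.
Qed.

(** Freeness over the abelian algebra of row vectors gives c. Its kernel is N^2 because the linear
    section s recovers x from c x modulo N^2. *)
Lemma freeNil_abelianization : (0 < t)%N ->
  exists c : N -> 'rV[K]_d, [/\ linear c, forall v, exists x, c x = v,
    forall x, c x = 0 <-> lcs 2 x & forall i, c (freeNil_gen i) = delta_mx 0 i].
Proof.
move=> t_gt0; pose A := abelianLie 'rV[K]_d.
have At : @lcs K A t.+1 = [set 0].
  (* As t > 0, the index t + 1 is at least 2, where the series of an abelian algebra is zero. *)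
  by case: t t_gt0 => // ? _; apply: abelian_lcs.
have [c [chom cg]] := freeNil_universal (fun i => delta_mx 0 i : A) At.
have [clin cL] := chom.
pose s (v : 'rV[K]_d) : N := \sum_i v 0 i *: freeNil_gen i.
have slin : linear s.
  move=> a u v; rewrite /s scaler_sumr -big_split /=; apply: eq_bigr => i _.
  by rewrite !mxE scalerDl scalerA.
have cs v : c (s v) = v.
  rewrite [RHS]row_sum_delta /s (big_morph c (linfunD clin) (linfun0 clin)).
  by apply: eq_bigr => i _; rewrite (linfunZ clin) cg.
have c2 x : lcs 2 x -> c x = 0.
  by move=> /(lie_hom_lcs chom); rewrite abelian_lcs.
have sc x : lcs 2 (x - s (c x)).
  move: x; apply: freeNil_ind.
  - split=> [|a u v Lu Lv] /=.
      by rewrite (linfun0 clin) (linfun0 slin) subrr; apply: lcs0.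
    by rewrite clin slin opprD addrACA -scalerBr; apply: lcs_lin.
  - move=> i /=; rewrite cg /s (bigD1 i) //= mxE !eqxx scale1r.
    rewrite big1 ?addr0 ?subrr.
      exact: lcs0.
    by move=> j ji; rewrite mxE eqxx (negPf ji) scale0r.
  - move=> x y _ _ /=; rewrite cL abelian_lieE (linfun0 slin) subr0.
    exact: lcs_lie.
exists c; split=> // [v|x]; first by exists (s v).
by split=> [cx0|/c2//]; have := sc x; rewrite cx0 (linfun0 slin) subr0.
Qed.

(** Send the generators to lifts of a basis of L/L^2: these generate L by nilpotency, and p respects
    the coordinates on the abelianizations. *)
Lemma freeNil_surj (L : lieAlgType K) : (0 < t)%N ->
  @lcs K L t.+1 = [set 0] -> has_type L d ->
  exists p : N -> L, [/\ lie_hom p, forall y, exists x, p x = y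
    & forall x, p x = 0 -> lcs 2 x].
Proof.
move=> t_gt0 Lt /has_typeP[c [clin csurj c0]].
have [e [elin esurj e0 eg]] := freeNil_abelianization t_gt0.
pose q i := projT1 (cid (csurj (delta_mx 0 i))).
have cq i : c (q i) = delta_mx 0 i := projT2 (cid (csurj (delta_mx 0 i))).
have [p [phom pg]] := freeNil_universal q Lt.
have [plin pL] := phom.
(* Both sides agree on generators and vanish on brackets. *)
have cp x : c (p x) = e x.
  move: x; apply: (@freeNil_ind [set x | c (p x) = e x]).
  - split=> [|a u v /= cu cv] /=; last by rewrite plin clin elin cu cv.
    by rewrite (linfun0 plin) (linfun0 clin) (linfun0 elin).
  - by move=> i /=; rewrite pg cq eg.
  - move=> x y _ _ /=; rewrite pL; transitivity (0 : 'rV[K]_d).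
      by apply/c0; apply: lcs_lie.
    by apply/esym/e0; apply: lcs_lie.
exists p; split=> // [|x px0]; last first.
  by apply/e0; rewrite -cp px0 (linfun0 clin).
apply: nilpotent_hom_surj phom Lt _ => y; have [x xE] := esurj (c y).
by exists x; apply/c0; rewrite (linfunB clin) cp xE subrr.
Qed.

(** Projectivity: each generator goes to a p-preimage of its prescribed value, and freeness extends
    this choice. *)
Lemma freeNil_lift (L M : lieAlgType K) (p : N -> M) (f : N -> L)
    (phi : L -> M) :
  lie_hom p -> (forall y, exists x, p x = y) -> lie_hom f -> lie_hom phi ->
  exists2 h : N -> N, lie_hom h & forall x, p (h x) = phi (f x).
Proof.
move=> [plin pL] psurj [flin fL] [philin phiL].
pose q i := projT1 (cid (psurj (phi (f (freeNil_gen i))))).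
have pq i : p (q i) = phi (f (freeNil_gen i)) := projT2 (cid (psurj _)).
have [h [[hlin hL] hg]] := freeNil_universal q freeNil_nilpotent.
exists h => //; apply: (@freeNil_ind [set x | p (h x) = phi (f x)]).
- split=> [|a u v /= pu pv] /=; last by rewrite hlin plin flin philin pu pv.
  by rewrite (linfun0 hlin) (linfun0 plin) (linfun0 flin) (linfun0 philin).
- by move=> i /=; rewrite hg pq.
- by move=> x y /= px py; rewrite hL pL fL phiL px py.
Qed.

(** Lifts of [phi] and of its inverse compose to the identity modulo the kernels of [p] and [q],
    hence modulo N^2. *)
Lemma freeNil_lift_iso (L M : lieAlgType K) (p : N -> L) (q : N -> M)
    (phi : L -> M) :
  lie_hom p -> (forall y, exists x, p x = y) ->
  (forall x, p x = 0 -> lcs 2 x) ->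
  lie_hom q -> (forall y, exists x, q x = y) ->
  (forall x, q x = 0 -> lcs 2 x) ->
  lie_iso phi ->
  exists2 theta, @lie_aut K N theta & forall x, q (theta x) = phi (p x).
Proof.
move=> phom psurj p2 qhom qsurj q2 [phih [psi phiK psiK]].
have psih := lie_hom_can phih phiK psiK.
have [f fh fE] := freeNil_lift qhom qsurj phom phih.
have [g gh gE] := freeNil_lift phom psurj qhom psih.
exists f => //; split=> //.
apply: (inverse_mod_lcs2_bij fh gh freeNil_nilpotent freeNil_nilpotent) => x.
  by apply: p2; rewrite (linfunB phom.1) gE fE phiK subrr.
by apply: q2; rewrite (linfunB qhom.1) fE gE psiK subrr.
Qed.

End FreeNilpotent.

(** * Invariant forms and the quadratic quotient by the kernel *)

Section InvariantForms.
Variables (K : fieldType) (L : lieAlgType K) (B : L -> L -> K).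
Hypothesis Binv : inv_form B.

Lemma inv_formDZl a x y z : B (a *: x + y) z = a * B x z + B y z.
Proof. by have [[lin _] _ _] := Binv; apply: lin. Qed.

Lemma inv_formC x y : B x y = B y x.
Proof. by have [_ + _] := Binv; apply. Qed.

Lemma inv_form_ker_submod : is_submod (form_ker B).
Proof.
have B0 y : B 0 y = 0.
  by have := inv_formDZl (-1) 0 0 y; rewrite scaler0 addr0 mulN1r addNr.
by split=> // a u v Bu Bv y; rewrite inv_formDZl Bu Bv mulr0 addr0.
Qed.

Lemma inv_form_ker_ideal x y : form_ker B x -> form_ker B (lie x y).
Proof. by have [_ _ Blie] := Binv; move=> Bx z; rewrite Blie. Qed.

Definition form_ker_ideal : lie_ideal L :=
  @LieIdeal K L (Submod inv_form_ker_submod) inv_form_ker_ideal.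

Lemma inv_form_kerB x x' y : form_ker B (x - x') -> B x y = B x' y.
Proof.
move=> Bxx'; rewrite -(subrK x' x) -[x - x']scale1r inv_formDZl.
by rewrite mul1r Bxx' add0r.
Qed.

Definition quot_form (x y : quotlie form_ker_ideal) : K := B (repr x) (repr y).

Lemma quot_form_pi x y :
  quot_form (lie_pi form_ker_ideal x) (lie_pi form_ker_ideal y) = B x y.
Proof.
have rp u : form_ker B (repr (lie_pi form_ker_ideal u) - u).
  exact: (repr_pi form_ker_ideal u).
rewrite /quot_form (inv_form_kerB _ (rp x)).
by rewrite inv_formC (inv_form_kerB _ (rp y)) inv_formC.
Qed.

Lemma quot_form_inv : inv_form quot_form.
Proof.
have [plin pL] := lie_pi_hom form_ker_ideal.
have psurj := @lie_pi_surj _ _ form_ker_ideal.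
have [[linl linr] _ Blie] := Binv.
split.
- split=> z a x y; have [z' <-] := psurj z; have [x' <-] := psurj x;
    have [y' <-] := psurj y; rewrite /= -plin !quot_form_pi.
    exact: linl.
  exact: linr.
- move=> x y; have [x' <-] := psurj x; have [y' <-] := psurj y.
  by rewrite !quot_form_pi inv_formC.
- move=> x y z; have [z' <-] := psurj z; have [x' <-] := psurj x.
  by have [y' <-] := psurj y; rewrite -!pL !quot_form_pi Blie.
Qed.

Lemma quot_form_nondeg : form_ker quot_form = [set 0].
Proof.
have psurj := @lie_pi_surj _ _ form_ker_ideal.
apply/seteqP; split=> [x|_ ->].
  have [{}x <-] := psurj x => kx; apply/lie_pi_eq0 => y.
  by rewrite -quot_form_pi.
move=> y; have [{}y <-] := psurj y.
rewrite -(linfun0 (lie_pi_hom form_ker_ideal).1) quot_form_pi.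
exact: inv_form_ker_submod.1.
Qed.

Definition quot_quad : quadLie K := QuadLie quot_form_inv quot_form_nondeg.

(** Nondegeneracy on Q makes the kernel of p exactly Ker B, so p factors through an isomorphism. *)
Lemma quot_quad_isometric (Q : quadLie K) (p : L -> Q) : lie_hom p ->
  (forall y, exists x, p x = y) ->
  (forall x y, quad_form (p x) (p y) = B x y) ->
  isometric quot_quad Q.
Proof.
move=> phom psurj pB.
have pker x : p x = 0 <-> form_ker B x.
  suff -> : form_ker B x <-> form_ker (@quad_form K Q) (p x).
    by rewrite quad_nondeg.
  split=> Bx y; last by rewrite -pB.
  by have [z <-] := psurj y; rewrite pB.
have [g [ghom gpi]] := quot_lie_factor (I := form_ker_ideal) phom
  (fun x => (pker x).2).
exists g; split; last first.
  move=> x y; have [u <-] := lie_pi_surj x; have [v <-] := lie_pi_surj y.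
  by rewrite !gpi pB; apply: quot_form_pi.
split=> //; apply: inj_surj_bijective => [|y].
  apply: (linfun_inj ghom.1) => x; have [u <-] := lie_pi_surj x.
  by rewrite gpi => /pker ku; apply/lie_pi_eq0.
by have [x <-] := psurj y; exists (lie_pi form_ker_ideal x).
Qed.

End InvariantForms.

(** * Isometry classes of quadratic Lie algebras *)

Lemma sig_eq (T : Type) (P : T -> Prop) (x y : T) (Px : P x) (Py : P y) :
  x = y -> exist P x Px = exist P y Py.
Proof. by move=> xy; subst y; rewrite (Prop_irrelevance Px Py). Qed.

Section Isometric.
Variables (K : fieldType) (d t : nat).
Implicit Types Q : quadLie K.

Lemma isometric_refl Q : isometric Q Q.
Proof. by exists id; split=> //; split; [split|exists id]. Qed.

Lemma isometric_sym Q Q' : isometric Q Q' -> isometric Q' Q.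
Proof.
move=> [f [[fh [g fK gK]] fB]]; exists g; split.
  by split; [apply: lie_hom_can fh fK gK|exists f].
by move=> x y; rewrite fB !gK.
Qed.

Lemma isometric_trans Q Q' Q'' :
  isometric Q Q' -> isometric Q' Q'' -> isometric Q Q''.
Proof.
move=> [f [[fh fb] fB]] [g [[gh gb] gB]]; exists (g \o f); split.
  by split; [apply: lie_hom_comp|apply: bij_comp].
by move=> x y; rewrite fB gB.
Qed.

Lemma isometry_class_eq Q Q' : nil_quad d t Q' ->
  isometry_class d t Q = isometry_class d t Q' <-> isometric Q Q'.
Proof.
move=> Q'nil; split=> [QQ'|QQ'].
  (* [Q'] belongs to its own class, hence to that of [Q]. *)
  suff : isometry_class d t Q Q' by case.
  by rewrite QQ'; split=> //; apply: isometric_refl.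
apply: functional_extensionality_dep => P; apply: propositional_extensionality.
split=> -[Pnil PQ]; split=> //; last exact: isometric_trans QQ' PQ.
exact: isometric_trans (isometric_sym QQ') PQ.
Qed.

End Isometric.

(** * Orbits of forms, isomorphism classes and isometry types *)

Section Sym0Orbits.
Variables (K : fieldType) (d t : nat).
Local Notation N := (freeNil K d t).
Implicit Types B : N -> N -> K.

Lemma sym0_inv B : @is_sym0 K d t B -> inv_form B.
Proof. by case. Qed.

Lemma lie_aut_comp (theta sigma : N -> N) :
  lie_aut theta -> lie_aut sigma -> lie_aut (theta \o sigma).
Proof.
move=> [th tb] [sh sb]; split; last exact: bij_comp.
exact: lie_hom_comp.
Qed.

Lemma lie_aut_inv (theta : N -> N) : lie_aut theta ->
  exists sigma : N -> N,
    [/\ lie_aut sigma, cancel theta sigma & cancel sigma theta].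
Proof.
move=> [th [sigma tK sK]]; exists sigma; split=> //.
by split; [apply: lie_hom_can th tK sK|exists theta].
Qed.

(** Automorphisms preserve the lower central series, and theta carries the kernel of the twisted
    form into Ker B; the inverse transports both kernel conditions. *)
Lemma twist_sym0 theta B : lie_aut theta -> @is_sym0 K d t B ->
  @is_sym0 K d t (twist B theta).
Proof.
move=> ta [[[linl linr] Bsym Blie] kB tB].
have [sigma [sa tK sK]] := lie_aut_inv ta.
have [[tlin tL] _] := ta; have [[slin sL] _] := sa.
have kerE x : form_ker (twist B theta) x -> form_ker B (theta x).
  by move=> kx y; rewrite -(sK y); apply: kx.
split.
- split=> [|x y|x y z]; rewrite /twist.
  + by split=> z a x y; rewrite /= tlin; [apply: linl|apply: linr].
  + exact: Bsym.
  + by rewrite !tL Blie.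
- move=> x /kerE /kB /(lie_hom_lcs sa.1); by rewrite tK.
- move=> tker; apply: tB => x /(lie_hom_lcs sa.1) /tker /kerE.
  by rewrite sK.
Qed.

Lemma form_orbit_refl B : form_orbit B B.
Proof. by exists id => //; split; [split|exists id]. Qed.

Lemma form_orbit_eq B B' : form_orbit B = form_orbit B' <-> form_orbit B B'.
Proof.
split=> [->|[theta ta <-]]; first exact: form_orbit_refl.
have [sigma [sa tK sK]] := lie_aut_inv ta.
apply/seteqP; split=> _ [rho ra <-].
  exists (sigma \o rho); first exact: lie_aut_comp.
  by rewrite /twist /=; do 2!(apply/funext => ?); rewrite !sK.
by exists (theta \o rho) => //; apply: lie_aut_comp.
Qed.

(** A representative f of an isomorphism is invertible modulo the kernels, hence modulo N^2, so it
    is an automorphism, and its inverse twists [B] into [B']. *)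
Lemma isomorphic_form_orbit (B B' : Sym0Cat K d t) :
  isomorphic B B' <-> form_orbit (sym0_form B) (sym0_form B').
Proof.
split.
- move=> [f [g []]]; elim/sym0_hom_ind: f => f; elim/sym0_hom_ind: g => g.
  rewrite /= !sym0_comp_pi => /sym0_homP gf /sym0_homP fg.
  have [fh fB _] := mendP f; have [gh gB _] := mendP g.
  have fbij : bijective f.
    apply: (inverse_mod_lcs2_bij fh gh (freeNil_nilpotent _ _ _)
      (freeNil_nilpotent _ _ _)) => x.
      by have [_ + _] := sym0P B; apply; apply: gf.
    by have [_ + _] := sym0P B'; apply; apply: fg.
  have [h [ha fK hK]] := lie_aut_inv (conj fh fbij : lie_aut f).
  exists h => //; apply/funext => x; apply/funext => y.
  by rewrite /twist fB !hK.
- move=> [theta ta tB].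
  have [sigma [sa tK sK]] := lie_aut_inv ta.
  have B'E x y : sym0_form B' x y = sym0_form B (theta x) (theta y).
    by rewrite -tB.
  (* Twisting pulls back: theta is a morphism from [B'] to [B], and its inverse goes from [B] to
     [B']. *)
  have fP : @is_mend K d t B B' sigma.
    split; first exact: sa.1.
      by move=> x y; rewrite B'E !sK.
    by move=> _ [x kx <-] y; rewrite B'E sK; apply: kx.
  have gP : @is_mend K d t B' B theta.
    split; first exact: ta.1.
      by move=> x y; rewrite B'E.
    by move=> _ [x kx <-] y; rewrite -(sK y) -B'E; apply: kx.
  exists (\pi_(sym0_hom B B') (Mend fP))%qT, (\pi_(sym0_hom B' B) (Mend gP))%qT.
  rewrite /= !sym0_comp_pi; split; apply/sym0_homP => x /=.
    by rewrite sK subrr; apply: (form_ker_submod B).1.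
  by rewrite tK subrr; apply: (form_ker_submod B').1.
Qed.

(** The step is exactly t because N^t is not inside Ker B; the coordinates on N/N^2 descend because
    Ker B lies in N^2. *)
Lemma sym0_quot_nil B (Binv : inv_form B) : (0 < t)%N ->
  @is_sym0 K d t B -> nil_quad d t (quot_quad Binv).
Proof.
move=> t_gt0 [_ kB tB]; pose I := form_ker_ideal Binv.
have phom := lie_pi_hom I; have psurj := @lie_pi_surj _ _ I.
split; first split.
- apply/seteqP; split=> [y|_ ->]; last exact: lcs0.
  move=> /(lie_hom_lcs_surj phom psurj)[x]; rewrite freeNil_nilpotent => -> <-.
  exact: (linfun0 phom.1).
- move=> lcst; apply: tB => x /(lie_hom_lcs phom).
  by rewrite [X in X _ -> _]lcst => /lie_pi_eq0.
- have [c [clin csurj c0 _]] := freeNil_abelianization K d t_gt0.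
  have [|g [glin gpi]] := quot_linear_factor (I := I) clin.
    by move=> x /kB /c0.
  apply/has_typeP; exists g; split=> // [v|y].
    by have [x <-] := csurj v; exists (lie_pi I x).
  have [x <-] := psurj y; rewrite gpi; split=> [/c0|].
    exact: lie_hom_lcs.
  (* Here z in N^2 has the same image as x, so z - x lies in Ker B, hence in N^2, and so does x. *)
  move=> /(lie_hom_lcs_surj phom psurj)[z z2 /lie_piP /kB zx]; apply/c0.
  by rewrite -(subKr z x); apply: lcsB.
Qed.

(** Isometries of the quotients lift to automorphisms; conversely, the projection after theta pulls
    the form of N/Ker B back to [B']. *)
Lemma isometric_form_orbit B B' (Binv : inv_form B) (Binv' : inv_form B') :
  @is_sym0 K d t B -> @is_sym0 K d t B' ->
  isometric (quot_quad Binv) (quot_quad Binv') <-> form_orbit B B'.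
Proof.
move=> sB sB'; split.
(* The inverse isometry is the one to lift: theta must cover a map from N/Ker B' to N/Ker B for [B']
   to be [twist B theta]. *)
- move=> /isometric_sym[phi [phi_iso phiB]].
  have [||theta ta thetaE] := freeNil_lift_iso
    (lie_pi_hom (form_ker_ideal Binv')) (@lie_pi_surj _ _ _) _
    (lie_pi_hom (form_ker_ideal Binv)) (@lie_pi_surj _ _ _) _ phi_iso.
  + by case: sB' => _ kB' _ x /lie_pi_eq0/kB'.
  + by case: sB => _ kB _ x /lie_pi_eq0/kB.
  exists theta => //; apply/funext => x; apply/funext => y.
  rewrite /twist -(quot_form_pi Binv) -(quot_form_pi Binv') !thetaE.
  exact/esym/phiB.
- move=> [theta ta tB]; apply/isometric_sym.
  apply: (@quot_quad_isometric _ _ _ _ (quot_quad Binv)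
    (lie_pi (form_ker_ideal Binv) \o theta)).
  + exact: lie_hom_comp ta.1 (lie_pi_hom _).
  + move=> y; have [x <-] := lie_pi_surj y.
    by have [sigma [_ _ sK]] := lie_aut_inv ta; exists (sigma x); rewrite /= sK.
  + by move=> x y /=; rewrite -tB; apply: quot_form_pi.
Qed.

(** Pull the form back along a surjection p from N. Nondegeneracy puts Ker B inside the kernel of p,
    hence in N^2, and N^t inside Ker B would force Q^t = 0. *)
Lemma nil_quad_sym0 (Q : quadLie K) : (0 < t)%N -> nil_quad d t Q ->
  exists2 B, @is_sym0 K d t B &
    forall Binv : inv_form B, isometric (quot_quad Binv) Q.
Proof.
move=> t_gt0 [[Qt Qt'] Qd].
have [p [phom psurj p2]] := freeNil_surj t_gt0 Qt Qd.
have [plin pL] := phom.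
have [[linl linr] Qsym Qlie] := quad_inv Q.
pose B x y := quad_form (p x) (p y).
have kerB x : form_ker B x -> p x = 0.
  move=> kx; suff : form_ker (@quad_form K Q) (p x) by rewrite quad_nondeg.
  by move=> y; have [z <-] := psurj y; apply: kx.
exists B => [|Binv]; last exact: (quot_quad_isometric _ phom psurj).
split=> [||tker].
- split=> [|x y|x y z]; rewrite /B.
  + by split=> z a x y; rewrite /= plin; [apply: linl|apply: linr].
  + exact: Qsym.
  + by rewrite !pL Qlie.
- by move=> x /kerB/p2.
- apply: Qt'; apply/seteqP; split=> [y|_ ->]; last exact: lcs0.
  by move=> /(lie_hom_lcs_surj phom psurj)[x /tker /kerB px0 <-].
Qed.

(** The form is picked by choice; another pick changes the quotient only up to isometry. *)
Definition sym0_orbit_rep (O : sym0_orbit K d t) : N -> N -> K :=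
  projT1 (cid (proj2_sig O)).

Lemma sym0_orbit_repP O :
  is_sym0 (sym0_orbit_rep O) /\ proj1_sig O = form_orbit (sym0_orbit_rep O).
Proof. exact: projT2 (cid (proj2_sig O)). Qed.

Definition sym0_orbit_quad (O : sym0_orbit K d t) : quadLie K :=
  quot_quad (sym0_inv (sym0_orbit_repP O).1).

(** An orbit goes to the isometry class of N/Ker B. Lifting isometries gives injectivity, pulling
    forms back gives surjectivity. *)
Lemma sym0_orbit_isometry_bij : (0 < t)%N ->
  exists f : sym0_orbit K d t -> isometry_type K d t, bijective f.
Proof.
move=> t_gt0.
have Onil O : nil_quad d t (sym0_orbit_quad O).
  exact: sym0_quot_nil (sym0_orbit_repP O).1.
have clP O : exists Q, nil_quad d t Q /\
    isometry_class d t (sym0_orbit_quad O) = isometry_class d t Q.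
  by exists (sym0_orbit_quad O).
exists (fun O => exist _ (isometry_class d t (sym0_orbit_quad O)) (clP O)).
apply: inj_surj_bijective => [O O'|[C [Q [Qnil CQ]]]].
  move=> /(congr1 (@proj1_sig _ _)) /= /(isometry_class_eq _ (Onil O')).
  move=> /isometric_form_orbit.
  move=> /(_ (sym0_orbit_repP O).1 (sym0_orbit_repP O').1) /form_orbit_eq.
  rewrite -(sym0_orbit_repP O).2 -(sym0_orbit_repP O').2.
  by case: O O' => [O OP] [O' OP'] /= OO'; apply: sig_eq.
have [B sB BQ] := nil_quad_sym0 t_gt0 Qnil.
have OP : exists B', is_sym0 B' /\ form_orbit B = form_orbit B' by exists B.
pose O : sym0_orbit K d t := exist _ (form_orbit B) OP; exists O.
apply: sig_eq; rewrite CQ; apply/(isometry_class_eq _ Qnil).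
(* The form chosen for [O] may differ from [B], but they share an orbit, so their quotients are
   isometric. *)
apply: isometric_trans _ (BQ (sym0_inv sB)).
apply: (isometric_form_orbit _ _ (sym0_orbit_repP O).1 sB).2.
apply/form_orbit_eq/esym; exact: (sym0_orbit_repP O).2.
Qed.

End Sym0Orbits.

Theorem lemma4p4 (K : fieldType) (d t : nat)
    (char0 : [pchar K] =i pred0) (d_ge1 : (1 <= d)%N) (t_ge1 : (1 <= t)%N) :
  [/\ (forall theta B, lie_aut theta -> @is_sym0 K d t B ->
         @is_sym0 K d t (twist B theta)),
      (forall B, @is_sym0 K d t B -> twist B id = B),
      (forall theta sigma B,
         lie_aut theta -> lie_aut sigma -> @is_sym0 K d t B ->
         twist B (theta \o sigma) = twist (twist B theta) sigma),
      (forall B : Sym0Cat K d t,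
         form_orbit (sym0_form B)
         = [set sym0_form B' | B' in
              [set B' : Sym0Cat K d t | isomorphic B B']])
    & exists f : sym0_orbit K d t -> isometry_type K d t, bijective f].
Proof.
split=> // [theta B|B|].
- exact: twist_sym0.
(* Each twist of [B] is again an object, so the orbit consists of forms of objects. *)
- apply/seteqP; split=> [_ [theta ta <-]|_ [B' /isomorphic_form_orbit + <-]//].
  exists (Sym0 (twist_sym0 ta (sym0P B))) => //.
  by apply/isomorphic_form_orbit; exists theta.
- exact: sym0_orbit_isometry_bij.
Qed.
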